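(* Let $G$ be a locally compact Hausdorff étale groupoid with compact unit space. Let $0<\epsilon<1/2$, and choose $m\in\mathbb{N}$ with $m\geq 2$. Let $n$ be a positive integer such that $(1-\epsilon/m)^n<\epsilon$. Suppose that $T_1\subset T_2\subset\cdots\subset T_n$ are compact subsets of $G$ which contain $G^{(0)}$ and are such that (i) for each $i\in\{1,\ldots,n\}$, $\displaystyle \frac1m<\frac{\inf_{w\in G^{(0)}}|T_iw|}{\sup_{w\in G^{(0)}}|wT_i|}\leq 1$; (ii) for each $i\in\{1,\ldots,n\}$, $\displaystyle \frac{\inf_{w\in G^{(0)}}|T_iw|}{\sup_{w\in G^{(0)}}|wT_i|}(1-\epsilon)\geq \frac1m$; and (iii) for each $i\in\{2,\ldots,n\}$ and each $w\in G^{(0)}$, $|\partial_{T_{i-1}}(T_iw)|\leq(\epsilon^2/8)|T_iw|$. Then every $(T_n,\epsilon^2/4)$-invariant compact subset of $G$ is $\epsilon$-quasitiled by $\{T_1,\ldots,T_n\}$.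
   Context: For a groupoid $G$ with range and source maps $r,s$, subsets $A,B\subset G$, $g\in G$ and $u\in G^{(0)}$: $AB=\{ab: a\in A,b\in B,s(a)=r(b)\}$, $Ag=\{ag: a\in A, s(a)=r(g)\}$, $Au=\{a\in A: s(a)=u\}$, $uA=\{a\in A: r(a)=u\}$. $G$ is étale if $r$ and $s$ are local homeomorphisms; then for compact $A$ the sets $Au$, $uA$ are finite with cardinality uniformly bounded in $u$. $|\cdot|$ denotes cardinality. Invariance: for nonempty compact $C,A\subset G$ and $\epsilon>0$, put $I_C(A)=\{a\in A: Ca\subset A\}$; $A$ is $(C,\epsilon)$-invariant if $|I_C(Au)|\geq(1-\epsilon)|Au|$ for each $u\in s(A)$. Boundary: $\partial_C(A)=\{g\in G: Cg\cap A\neq\emptyset\text{ and }Cg\cap (G\setminus A)\neq\emptyset\}$. Let $A\subset G$ be compact and $\{A_i\}_{i\in I}$ a collection of compact subsets of $A$. It $\lambda$-covers $A$ if $|\bigcup_{i}A_iu|\geq\lambda|Au|$ for each $u\in s(A)$. It is $\epsilon$-disjoint if for each $u\in s(A)$ there are subsets $\widehat{A_{i,u}}\subset A_iu$ ($i\in I$), pairwise disjoint, with $|\widehat{A_{i,u}}|\geq(1-\epsilon)|A_iu|$. Quasitiling: a finite collection $\{T_1,\ldots,T_n\}$ of compact subsets of $G$ $\epsilon$-quasitiles a compact set $A\subset G$ if there exist $C_1,\ldots,C_n\subset G$ such that $\bigcup_{i=1}^nT_iC_i\subset A$ and the collection of right translates $\{T_ic: i\in\{1,\ldots,n\},c\in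 C_i\}$ is $\epsilon$-disjoint and $(1-\epsilon)$-covers $A$. *)

(* Defs.v *)
From HB Require Import structures.
From mathcomp Require Import all_boot all_order all_algebra.
From mathcomp Require Import finmap.
From mathcomp Require Import all_classical all_reals topology.

Set Implicit Arguments.
Unset Strict Implicit.
Unset Printing Implicit Defensive.

Import Order.TTheory GRing.Theory Num.Theory.

Local Open Scope classical_set_scope.
Local Open Scope ring_scope.

(* A groupoid is presented by its set of arrows; units are identified with
   identity arrows, so that [rng] and [src] are idempotent self-maps.
   [gmul] is a total function, but it is constrained only on composable pairs
   (src x = rng y); its values elsewhere are arbitrary and never used below. *)
HB.mixin Record isGroupoid G := {
  rng : G -> G;
  src : G -> G;
  gmul : G -> G -> G;
  ginv : G -> G;
  rng_rng : forall x, rng (rng x) = rng x;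
  src_rng : forall x, src (rng x) = rng x;
  rng_src : forall x, rng (src x) = src x;
  src_src : forall x, src (src x) = src x;
  rng_mul : forall x y, src x = rng y -> rng (gmul x y) = rng x;
  src_mul : forall x y, src x = rng y -> src (gmul x y) = src y;
  gmulA : forall x y z, src x = rng y -> src y = rng z ->
    gmul x (gmul y z) = gmul (gmul x y) z;
  gmul_rng : forall x, gmul (rng x) x = x;
  gmul_src : forall x, gmul x (src x) = x;
  rng_inv : forall x, rng (ginv x) = src x;
  src_inv : forall x, src (ginv x) = rng x;
  gmulV : forall x, gmul x (ginv x) = rng x;
  gmulVl : forall x, gmul (ginv x) x = src x
}.

#[short(type="groupoidType")]
HB.structure Definition Groupoid := {G of isGroupoid G}.

Definition unit_space (G : groupoidType) : set G := range (@rng G).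
Arguments unit_space G : clear implicits.

Definition composable (G : groupoidType) : set (G * G) :=
  [set p | src p.1 = rng p.2].
Arguments composable G : clear implicits.

HB.mixin Record isTopGroupoid G of Topological G & isGroupoid G := {
  gmul_continuous :
    {within composable G, continuous (fun p : G * G => gmul p.1 p.2)};
  ginv_continuous : continuous (@ginv G)
}.

#[short(type="topGroupoidType")]
HB.structure Definition TopGroupoid :=
  {G of Topological G & isGroupoid G & isTopGroupoid G}.

(* [f : X -> Y] takes its values in [B] and is a local homeomorphism from [X]
   to [B], where [B] carries the topology induced from [Y]. *)
Definition local_homeomorphism (X Y : topologicalType) (B : set Y)
    (f : X -> Y) : Prop :=
  (forall x, B (f x)) /\
  forall x, exists U : set X,
    [/\ open U, U x, @open (subspace B) (f @` U),
        {within U, continuous f} &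
        exists2 g : Y -> X, {in U, cancel f g} &
          {within f @` U, continuous g}].

Definition etale (G : topGroupoidType) : Prop :=
  local_homeomorphism (unit_space G) (@rng G) /\
  local_homeomorphism (unit_space G) (@src G).

(* Cardinality of a finite set; an infinite set gets the junk value 0.  In an
   étale groupoid, all the sets measured below (fibers of a compact set, their
   subsets, and boundaries of fibers of compact sets) are finite. *)
Definition setcard (T : choiceType) (A : set T) : nat := #|` fset_set A|.

Section GroupoidSets.
Context {G : topGroupoidType}.
Implicit Types (A B C : set G) (g u w : G).

Definition setgmul A B : set G :=
  [set gmul p.1 p.2 | p in (A `*` B) `&` composable G].

Definition translate A g : set G := setgmul A [set g].

Definition src_fiber A u : set G := [set a | A a /\ src a = u].

Definition rng_fiber u A : set G := [set a | A a /\ rng a = u].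

Definition invariant_part C A : set G := [set a | A a /\ translate C a `<=` A].

Definition boundary C A : set G :=
  [set g | translate C g `&` A !=set0 /\ translate C g `&` ~` A !=set0].

Section Real.
Context {R : realType}.
Implicit Types (eps lambda : R).

Definition approx_invariant C eps A : Prop :=
  [/\ compact C, C !=set0, compact A, A !=set0 &
      forall u, (src @` A) u ->
        (setcard (invariant_part C (src_fiber A u)))%:R
          >= (1 - eps) * (setcard (src_fiber A u))%:R].

(* The collection is the indexed family (F i), i ranging over D. *)
Definition covers (I : Type) (D : set I) (F : I -> set G) lambda A : Prop :=
  forall u, (src @` A) u ->
    (setcard (\bigcup_(i in D) src_fiber (F i) u))%:R
      >= lambda * (setcard (src_fiber A u))%:R.

Definition eps_disjoint (I : Type) (D : set I) (F : I -> set G) eps A : Prop :=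
  forall u, (src @` A) u -> exists H : I -> set G,
    [/\ forall i, D i -> H i `<=` src_fiber (F i) u,
        trivIset D H &
        forall i, D i ->
          (setcard (H i))%:R >= (1 - eps) * (setcard (src_fiber (F i) u))%:R].

(* The tiles are T 1, ..., T n; the translates form a family indexed by the
   pairs (i, c) with 1 <= i <= n and c in C i. *)
Definition quasitiles (n : nat) (T : nat -> set G) eps A : Prop :=
  exists C : nat -> set G,
    let D := [set p : nat * G | (1 <= p.1 <= n)%N /\ C p.1 p.2] in
    let F := fun p : nat * G => translate (T p.1) p.2 in
    [/\ \bigcup_(i in [set i | (1 <= i <= n)%N]) setgmul (T i) (C i) `<=` A,
        eps_disjoint D F eps A &
        covers D F (1 - eps) A].

End Real.

(* For compact [A] in an étale groupoid with nonempty unit space, these are the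
   infimum and supremum of a bounded nonempty set of reals. *)
Definition inf_src_card (R : realType) A : R :=
  inf [set (setcard (src_fiber A w))%:R | w in unit_space G].

Definition sup_rng_card (R : realType) A : R :=
  sup [set (setcard (rng_fiber w A))%:R | w in unit_space G].

End GroupoidSets.

(* Main.v *)
Require Import Defs.
From mathcomp Require Import all_boot all_order all_algebra finmap.
From mathcomp Require Import all_classical all_reals topology.
From mathcomp Require Import ring lra zify.

Set Implicit Arguments.
Unset Strict Implicit.
Unset Printing Implicit Defensive.

Import Order.TTheory GRing.Theory Num.Theory.

Local Open Scope classical_set_scope.
Local Open Scope ring_scope.

(** The tiling is built separately in each source fiber Au of the invariant set
A: a translate Tc lies in the single fiber over s(c), and nothing is asked of
the sets of centers beyond the fiberwise conditions. A compact set meets each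
fiber of a local homeomorphism in finitely many points, so the theorem reduces to
a statement about the finite set X = Au and the finite sets Tc with c in X.

That statement, [finite_quasitiling], is the Ornstein-Weiss greedy argument.
Place translates of the largest tile T_n first, then of T_(n-1), and so on down
to T_1. At stage i, let V be the part of X covered so far, and keep adding
translates of T_i inside X as long as a fraction at least 1 - eps of the new one
is uncovered; what it newly covers serves as its disjoint piece. When this
stops ([packing_saturate]), every translate of T_i inside X has at least a
fraction eps of its points covered.

If V misses at least eps |X| points, then most of those points c are free: T_i c
lies in X and avoids V ([card_free_centers]). A point c of X outside V fails to
be free either because T_n c leaves X, which by invariance happens for at most
eps^2/4 |X| points, or because T_i c meets an earlier tile T_j c'. As c itself
lies in T_i c but not in T_j c', it then lies in the boundary of T_j c' with
respect to T_(j-1), of size at most eps^2/8 |T_j c'|; the eps-disjoint earlier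
tiles have total size at most |V|/(1 - eps) <= 2|X|, so this loses at most
another eps^2/4 |X|.

For a free center c, the covered fraction eps of T_i c consists of points covered
at stage i. A given point g lies in T_i c for at most |r(g)T_i| centers c, so
double counting bounds the gain of stage i below by
eps (1 - eps) (inf|T_i w| / sup|wT_i|) |X \ V| >= (eps/m) |X \ V|
([tiling_step]). The uncovered part thus shrinks by the factor 1 - eps/m at each
of the n stages until it falls below eps |X|, and (1 - eps/m)^n < eps.

The passage from the groupoid to finite sets is right division by c: it carries
Tc injectively to the fiber of T over r(c), and the boundary of Tc to the
boundary of that fiber. *)

(** * Counting in finite sets *)

Section DoubleCounting.
Local Open Scope fset_scope.
Local Open Scope ring_scope.
Local Open Scope nat_scope.
Variables P K : choiceType.
Implicit Types (D : {fset P}) (W : {fset K}) (F : P -> {fset K}).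

Lemma card_fset_filter (T : choiceType) (B : {fset T}) (p : pred T) :
  #|` [fset x in B | p x]| = \sum_(x <- B) (p x).
Proof. by rewrite card_fset_sum1 big_fset [LHS]big_mkcond. Qed.

(** Both sides count the pairs (p, g) with g in both F p and W. *)
Lemma sum_card_fsetI D F W :
  \sum_(p <- D) #|` F p `&` W| = \sum_(g <- W) #|` [fset p in D | g \in F p]|.
Proof.
transitivity (\sum_(p <- D) \sum_(g <- W) (g \in F p)).
  apply: eq_bigr => p _; rewrite -card_fset_filter; congr (#|` _|).
  by apply/fsetP => g; rewrite !inE andbC.
by rewrite exchange_big /=; apply: eq_bigr => g _; rewrite card_fset_filter.
Qed.

Lemma card_bigfcup_le D F : #|` \bigcup_(p <- D) F p| <= \sum_(p <- D) #|` F p|.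
Proof.
elim/big_rec2: _ => [|p s A _ IH]; first by rewrite cardfs0.
by rewrite (leq_trans _ (leq_add (leqnn _) IH)) // cardfsU leq_subr.
Qed.

End DoubleCounting.

Lemma card_le_inj (T T' : choiceType) (f : T -> T') (X : {fset T}) (B : set T') :
  finite_set B -> {in X &, injective f} -> (forall z, z \in X -> B (f z)) ->
  (#|` X| <= setcard B)%N.
Proof.
move=> finB injf XB; rewrite -(card_in_imfset imfset_key injf) fsubset_leq_card //.
by apply/fsubsetP => _ /imfsetP[x /= xX ->]; rewrite in_fset_set // inE; apply: XB.
Qed.

(** * Maximal families of almost disjoint sets *)

Section Packing.
Local Open Scope fset_scope.
Local Open Scope ring_scope.
Variables (R : realFieldType) (P K : choiceType) (F : P -> {fset K}) (eps : R).
Implicit Types (D : {fset P}) (p q : P).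

Definition packing D : Prop := exists H : P -> {fset K},
  [/\ forall p, p \in D -> H p `<=` F p,
      forall p q, p \in D -> q \in D -> p != q -> [disjoint H p & H q] &
      forall p, p \in D -> (1 - eps) * (#|` F p|)%:R <= (#|` H p|)%:R].

Lemma packing0 : packing fset0.
Proof. by exists (fun=> fset0); split => [p|p q|p]; rewrite inE. Qed.

(** The disjoint pieces fill the fraction 1 - eps of each set and fit together
inside the union. *)
Lemma packing_sum D : packing D ->
  (1 - eps) * (\sum_(p <- D) #|` F p|)%:R <= (#|` \bigcup_(p <- D) F p|)%:R.
Proof.
case=> H [HF dH cH].
apply: (@le_trans _ _ (\sum_(p <- D) #|` H p|)%:R).
  rewrite !natr_sum mulr_sumr big_seq [leRHS]big_seq.
  by apply: ler_sum => p /cH.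
rewrite ler_nat.
under eq_bigr do rewrite card_fset_sum1.
rewrite -partition_disjoint_bigfcup // -card_fset_sum1 fsubset_leq_card //.
apply/bigfcupsP => p pD _; apply: fsubset_trans (HF _ pD) _.
exact: bigfcup_sup.
Qed.

Lemma packing_add D p : packing D ->
  (1 - eps) * (#|` F p|)%:R <= (#|` F p `\` \bigcup_(q <- D) F q|)%:R ->
  p \notin D -> packing (p |` D).
Proof.
case=> H [HF dH cH] cp pD.
set V := \bigcup_(q <- D) F q in cp.
have disjV q : q \in D -> [disjoint F p `\` V & H q].
  move=> qD; apply/fdisjointP => g; rewrite inE => /andP[gV _].
  apply: contra gV => gH; apply: (fsubsetP (bigfcup_sup _ qD isT)).
  exact: (fsubsetP (HF q qD)).
exists (fun q => if q == p then F p `\` V else H q); split.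
- move=> q; rewrite in_fset1U; case: eqP => [-> _|_ /= /HF //].
  exact: fsubsetDl.
- move=> q q'; rewrite !in_fset1U.
  case: (eqVneq q p) => [->|_]; case: (eqVneq q' p) => [->|_] //=.
  + by move=> _ q'D _; apply: disjV.
  + by move=> qD _ _; rewrite fdisjoint_sym; apply: disjV.
  + exact: dH.
- by move=> q; rewrite in_fset1U; case: eqP => [-> _|_ /= /cH].
Qed.

(** Greedy construction: going through the candidates s one at a time, add the
current one to the family if the part of it left uncovered is at least a fraction
1 - eps, in which case that part is its disjoint piece. A rejected candidate has
more than a fraction eps of its points covered, and an accepted one is covered
entirely; later additions preserve both. *)
Lemma packing_saturate D (s : seq P) : 0 <= eps <= 1 -> packing D ->
  exists D', [/\ D `<=` D', packing D',
    forall p, p \in D' -> p \notin D -> p \in s &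
    forall p, p \in s ->
      eps * (#|` F p|)%:R <= (#|` F p `&` \bigcup_(q <- D') F q|)%:R].
Proof.
move=> /andP[eps0 eps1] pD; elim: s => [|p s [D1 [DD1 pD1 D1s satD1]]].
  by exists D; split => // p pD' /negP.
have grow D2 q : D1 `<=` D2 ->
    eps * (#|` F q|)%:R <= (#|` F q `&` \bigcup_(q <- D1) F q|)%:R ->
    eps * (#|` F q|)%:R <= (#|` F q `&` \bigcup_(q <- D2) F q|)%:R.
  move=> D12 /le_trans; apply; rewrite ler_nat fsubset_leq_card // fsetIS //.
  apply/bigfcupsP => r rD1 _; apply: bigfcup_sup => //.
  exact: (fsubsetP D12).
have splitF : ((#|` F p|)%:R = (#|` F p `&` \bigcup_(q <- D1) F q|)%:R
    + (#|` F p `\` \bigcup_(q <- D1) F q|)%:R :> R)%R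
  by rewrite -natrD cardfsID.
have [satp|unsatp] := leP (eps * (#|` F p|)%:R)
    ((#|` F p `&` \bigcup_(q <- D1) F q|)%:R : R).
  exists D1; split => // [q qD1 qD|q].
    by rewrite inE (D1s q) ?orbT.
  by rewrite inE => /orP[/eqP->//|/satD1].
have pND1 : p \notin D1.
  apply/negP => pD1'; move: unsatp; rewrite (fsetIidPl _); last exact: bigfcup_sup.
  by rewrite ltNge ler_piMl.
exists (p |` D1); split.
- by apply: fsubset_trans DD1 _; apply: fsubsetU1.
- by apply: packing_add => //; lra.
- by move=> q; rewrite in_fset1U inE => /orP[->//|qD1 /(D1s q qD1)->]; rewrite orbT.
- move=> q; rewrite inE => /orP[/eqP->|/satD1]; last first.
    by apply: grow; apply: fsubsetU1.
  rewrite (fsetIidPl _); first by rewrite ler_piMl.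
  by apply: bigfcup_sup; rewrite // fset1U1.
Qed.

End Packing.

(** * Quasitilings of a finite set *)

Section FiniteQuasitiling.
Local Open Scope fset_scope.
Local Open Scope ring_scope.
(** X stands for a source fiber of the invariant set and [tile i c] for the
translate T_i c; [smin i] and [rmax i] stand for inf|T_i w| and sup|wT_i|. *)
Variables (R : realFieldType) (K : choiceType) (X : {fset K}) (n m : nat).
Variables (eps : R) (tile : nat -> K -> {fset K}) (smin rmax : nat -> R).
Hypotheses (eps_gt0 : 0 < eps) (eps_lt : eps < 1 / 2) (m_gt0 : (0 < m)%N).
Hypothesis tile_refl :
  forall i c, (1 <= i <= n)%N -> c \in X -> c \in tile i c.
Hypothesis tile_mono :
  forall i j c, (1 <= i <= j)%N -> (j <= n)%N -> tile i c `<=` tile j c.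
Hypothesis tile_low :
  forall i c, (1 <= i <= n)%N -> c \in X -> smin i <= (#|` tile i c|)%:R.
Hypothesis tile_high : forall i g, (1 <= i <= n)%N -> g \in X ->
  (#|` [fset c in X | g \in tile i c]|)%:R <= rmax i.
Hypothesis rmax_gt0 : forall i, (1 <= i <= n)%N -> 0 < rmax i.
Hypothesis rmax_smin : forall i, (1 <= i <= n)%N ->
  rmax i / m%:R <= smin i * (1 - eps).

(** The part in X of the boundary of a tile with respect to the preceding, smaller
tile shape. *)
Definition straddle (j : nat) (c : K) : {fset K} :=
  [fset g in X | ~~ [disjoint tile j.-1 g & tile j c]%fset
                   && ~~ (tile j.-1 g `<=` tile j c)].

Hypothesis straddle_small : forall j c, (2 <= j <= n)%N -> c \in X ->
  (#|` straddle j c|)%:R <= eps ^+ 2 / 8 * (#|` tile j c|)%:R.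
Hypothesis almost_inv :
  (1 - eps ^+ 2 / 4) * (#|` X|)%:R <= (#|` [fset c in X | tile n c `<=` X]|)%:R.

Let F (p : nat * K) := tile p.1 p.2.
Let U (D : {fset nat * K}) := \bigcup_(p <- D) F p.

(** Count the pairs (c, g) with c in B and g in both W and the tile at c: each c
contributes at least eps times the smallest tile size, each g at most the largest
number of tiles through one point. *)
Lemma tile_double_counting i (B W : {fset K}) : (1 <= i <= n)%N ->
  B `<=` X -> W `<=` X ->
  (forall c, c \in B -> eps * (#|` tile i c|)%:R <= (#|` tile i c `&` W|)%:R) ->
  eps * smin i * (#|` B|)%:R <= rmax i * (#|` W|)%:R.
Proof.
move=> hi /fsubsetP BX /fsubsetP WX sat.
apply: (@le_trans _ _ (\sum_(c <- B) #|` tile i c `&` W|)%:R).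
  rewrite card_fset_sum1 !natr_sum mulr_sumr big_seq [leRHS]big_seq.
  apply: ler_sum => c cB; rewrite mulr1; apply: le_trans (sat c cB).
  by rewrite ler_pM2l // tile_low // BX.
rewrite sum_card_fsetI card_fset_sum1 !natr_sum mulr_sumr.
rewrite big_seq [leRHS]big_seq; apply: ler_sum => g gW; rewrite mulr1.
apply: le_trans (tile_high hi (WX g gW)); rewrite ler_nat fsubset_leq_card //.
by apply/fsubsetP => c; rewrite !inE => /andP[/BX-> ->].
Qed.

(** Centers at which a tile of shape i can still be placed without touching the
part V covered by earlier tiles. *)
Definition free_centers i (V : {fset K}) : {fset K} :=
  [fset c in X `\` V | (tile i c `<=` X) && [disjoint tile i c & V]%fset].

(** An uncovered point c that is not free either has a tile sticking out of X, a
loss of at most eps^2/4 |X| by almost invariance, or has a tile of shape i meeting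
an earlier, larger tile. The larger tile does not contain c, so c straddles it;
summing the sizes of these straddling sets over an almost disjoint family costs
eps^2/8 times 2|X|. *)
Lemma card_free_centers i D : (1 <= i <= n)%N ->
  (forall p, p \in D -> [/\ (i < p.1 <= n)%N, p.2 \in X & F p `<=` X]) ->
  packing F eps D ->
  (#|` X `\` U D|)%:R <= (#|` free_centers i (U D)|)%:R
                         + eps ^+ 2 / 2 * (#|` X|)%:R.
Proof.
move=> hi hD pD.
pose J := [fset c in X | tile n c `<=` X].
pose bad := \bigcup_(p <- D) straddle p.1 p.2.
have sub : X `\` U D `<=` free_centers i (U D) `|` ((X `\` J) `|` bad).
  apply/fsubsetP => c; rewrite !inE => /andP[cU cX]; rewrite cX cU /=.
  have ci := tile_refl hi cX.
  have [nX|_ /=] := boolP (tile n c `<=` X); last by rewrite orbT.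
  have [i1 iN] := andP hi; rewrite (fsubset_trans _ nX) ?tile_mono ?i1 ?leqnn //=.
  have [//|/fdisjointP ndisj /=] := boolP [disjoint tile i c & U D]%fset.
  have [g gi /bigfcupP[p /andP[Dp _] gp]] :
      exists2 g, g \in tile i c & g \in U D.
    apply: contra_notP ndisj => nex g gi; apply/negP => gU.
    by apply: nex; exists g.
  have [/andP[ip pn] pX FX] := hD p Dp.
  have tip : tile i c `<=` tile p.1.-1 c.
    apply: tile_mono; last exact: leq_trans (leq_pred _) pn.
    by rewrite i1 -ltnS (ltn_predK ip).
  apply/bigfcupP; exists p; rewrite ?Dp // !inE cX /=; apply/andP; split.
    apply/negP => /fdisjointP /(_ g (fsubsetP tip g gi)).
    by rewrite gp.
  apply: contra cU => /fsubsetP/(_ c (fsubsetP tip c ci)) cp.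
  by apply/bigfcupP; exists p; rewrite ?Dp.
have UX : U D `<=` X by apply/bigfcupsP => p /hD[].
have cbad : (#|` bad|)%:R <= eps ^+ 2 / 8 * (\sum_(p <- D) #|` F p|)%:R.
  apply: (@le_trans _ _ (\sum_(p <- D) #|` straddle p.1 p.2|)%:R).
    by rewrite ler_nat card_bigfcup_le.
  rewrite !natr_sum mulr_sumr big_seq [leRHS]big_seq.
  apply: ler_sum => p Dp; have [/andP[ip pn] pX _] := hD p Dp.
  apply: straddle_small => //; rewrite pn andbT (leq_trans _ ip) ?ltnS //.
  by case/andP: hi.
have sumF : (\sum_(p <- D) #|` F p|)%:R <= 2 * (#|` X|)%:R :> R.
  have := packing_sum pD; rewrite -/(U D).
  have : (#|` U D|)%:R <= (#|` X|)%:R :> R by rewrite ler_nat fsubset_leq_card.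
  have : 0 <= (1 / 2 - eps) * (\sum_(p <- D) #|` F p|)%:R.
    by rewrite mulr_ge0 // subr_ge0 ltW.
  by lra.
have cJ : (#|` X `\` J|)%:R <= eps ^+ 2 / 4 * (#|` X|)%:R.
  have : (#|` J|)%:R + (#|` X `\` J|)%:R = (#|` X|)%:R :> R.
    rewrite -natrD -(cardfsID J X) (fsetIidPr _) //.
    by apply/fsubsetP => c; rewrite inE => /andP[].
  by have := almost_inv; rewrite -/J; lra.
have : (#|` X `\` U D|)%:R <= (#|` free_centers i (U D)|)%:R
    + ((#|` X `\` J|)%:R + (#|` bad|)%:R) :> R.
  rewrite -!natrD ler_nat (leq_trans (fsubset_leq_card sub)) //.
  rewrite (leq_trans (leq_card_fsetU _ _)) // leq_add2l.
  exact: leq_card_fsetU.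
have : eps ^+ 2 / 8 * (\sum_(p <- D) #|` F p|)%:R
    <= eps ^+ 2 / 8 * (2 * (#|` X|)%:R).
  by rewrite ler_wpM2l // divr_ge0 // sqr_ge0.
by lra.
Qed.

(** Saturating with tiles of shape i covers a fraction eps of the tile at every free
center, and all of that is new because such a tile avoids the part already
covered. Since at least a fraction 1 - eps of the uncovered points are free, double
counting turns this into a gain of a fraction eps/m of the uncovered part. *)
Lemma tiling_step i D : (1 <= i <= n)%N ->
  (forall p, p \in D -> [/\ (i < p.1 <= n)%N, p.2 \in X & F p `<=` X]) ->
  packing F eps D -> eps * (#|` X|)%:R <= (#|` X `\` U D|)%:R ->
  exists D', [/\
    forall p, p \in D' -> [/\ (i <= p.1 <= n)%N, p.2 \in X & F p `<=` X],
    packing F eps D' &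
    (#|` X `\` U D'|)%:R <= (1 - eps / m%:R) * (#|` X `\` U D|)%:R].
Proof.
move=> hi hD pD big; have [i1 iN] := andP hi.
have eps01 : 0 <= eps <= 1 by move: eps_gt0 eps_lt => ? ?; apply/andP; split; lra.
have [D' [DD' pD' newD' satD']] := packing_saturate
  [seq (i, c) | c <- [fset c in X | tile i c `<=` X]] eps01 pD.
have hD' p : p \in D' -> [/\ (i <= p.1 <= n)%N, p.2 \in X & F p `<=` X].
  move=> pD'1; have [/hD[/andP[/ltnW-> ->] -> ->]//|pND] := boolP (p \in D).
  have /mapP[c + ->] := newD' p pD'1 pND.
  by rewrite !inE /F /= leqnn iN => /andP[-> ->].
exists D'; split => //.
have UX : U D `<=` X by apply/bigfcupsP => p /hD[].
have UX' : U D' `<=` X by apply/bigfcupsP => p /hD'[].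
have UU' : U D `<=` U D'.
  by apply/bigfcupsP => p pD1 _; apply: bigfcup_sup => //; apply: (fsubsetP DD').
pose W := U D' `\` U D; pose B := free_centers i (U D).
have BX : B `<=` X by apply/fsubsetP => c; rewrite !inE => /andP[/andP[]].
have low : eps * smin i * (#|` B|)%:R <= rmax i * (#|` W|)%:R.
  apply: tile_double_counting => //; first by apply: fsubset_trans (fsubsetDl _ _) _.
  move=> c; rewrite !inE => /andP[/andP[cU cX] /andP[tX dis]].
  have -> : tile i c `&` W = tile i c `&` U D'.
    apply/fsetP => g; rewrite !inE; case: (boolP (g \in tile i c)) => //= gi.
    by rewrite (fdisjointP dis).
  by apply: (satD' (i, c)); apply/mapP; exists c => //; rewrite !inE cX.
have cB := card_free_centers hi hD pD; rewrite -/B in cB.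
have splitX : (#|` X `\` U D|)%:R = (#|` X `\` U D'|)%:R + (#|` W|)%:R :> R.
  rewrite -natrD !cardfsDS //; congr (_%:R).
  by rewrite -{1}(subnK (fsubset_leq_card UX')) -addnBA // fsubset_leq_card.
have m0 : 0 < m%:R :> R by rewrite ltr0n.
have B1 : (1 - eps) * (#|` X `\` U D|)%:R <= (#|` B|)%:R.
  have : 0 <= eps * (#|` X `\` U D|)%:R by rewrite mulr_ge0 // ltW.
  have : eps * (eps * (#|` X|)%:R) <= eps * (#|` X `\` U D|)%:R.
    by rewrite ler_pM2l.
  by lra.
have L0 : 0 <= smin i * (1 - eps).
  by apply: le_trans (rmax_smin hi); rewrite divr_ge0 ?ltW ?rmax_gt0.
suff : eps / m%:R * (#|` X `\` U D|)%:R <= (#|` W|)%:R by lra.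
rewrite -(ler_pM2l (rmax_gt0 hi)); apply: le_trans low.
have L1 : 0 <= smin i by move: L0; rewrite pmulr_lge0 // subr_gt0; move: eps_lt => ?; lra.
apply: (@le_trans _ _ (eps * (smin i * (1 - eps)) * (#|` X `\` U D|)%:R)).
  rewrite (_ : rmax i * _ = eps * (rmax i / m%:R) * (#|` X `\` U D|)%:R); last by ring.
  by rewrite ler_wpM2r // ler_wpM2l ?rmax_smin // ltW.
rewrite -!mulrA ler_wpM2l ?(ltW eps_gt0) // ler_wpM2l //.
Qed.

(** Tile shapes are used in the order n, n-1, ..., 1. Each stage multiplies the
uncovered part by at most 1 - eps/m, unless less than eps |X| is left, in which case
the remaining stages do nothing. *)
Lemma finite_quasitiling : (1 - eps / m%:R) ^+ n < eps ->
  exists D, [/\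
    forall p, p \in D -> [/\ (1 <= p.1 <= n)%N, p.2 \in X & F p `<=` X],
    packing F eps D & (1 - eps) * (#|` X|)%:R <= (#|` U D|)%:R].
Proof.
move=> hmn.
have m1 : 1 <= m%:R :> R by rewrite ler1n.
have q0 : 0 <= 1 - eps / m%:R.
  rewrite subr_ge0 ler_pdivrMr ?(lt_le_trans ltr01) // mul1r.
  by move: eps_lt => ?; lra.
suff /(_ n (leqnn n)) [D [hD pD rem]] : forall k, (k <= n)%N -> exists D, [/\
    forall p, p \in D -> [/\ (n - k < p.1 <= n)%N, p.2 \in X & F p `<=` X],
    packing F eps D &
    (#|` X `\` U D|)%:R < eps * (#|` X|)%:R \/
    (#|` X `\` U D|)%:R <= (1 - eps / m%:R) ^+ k * (#|` X|)%:R].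
  rewrite subnn in hD; exists D; split => //.
  have UX : U D `<=` X by apply/bigfcupsP => p /hD[].
  have : (#|` U D|)%:R + (#|` X `\` U D|)%:R = (#|` X|)%:R :> R.
    by rewrite -natrD -(cardfsID (U D) X) (fsetIidPr _).
  have : 0 <= (#|` X|)%:R :> R by [].
  by case: rem; nra.
elim=> [_|k IH kn].
  exists fset0; split; [by move=> p; rewrite inE|exact: packing0|right].
  by rewrite expr0 mul1r ler_nat fsubset_leq_card // fsubsetDl.
have [D [hD pD rem]] := IH (ltnW kn).
have [small|big] := ltP (#|` X `\` U D|)%:R (eps * (#|` X|)%:R).
  exists D; split; [|by []|left] => // p /hD[/andP[kp ->] -> ->].
  by rewrite andbT (leq_ltn_trans _ kp) // leq_sub2l.
have [||||D' [hD' pD' rem']] := @tiling_step (n - k)%N D.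
- by rewrite subn_gt0 kn leq_subr.
- by move=> p /hD.
- by [].
- by [].
exists D'; split; [by move=> p /hD'; rewrite subnSK|by []|right].
case: rem => [|rem]; first by rewrite ltNge big.
by apply: le_trans rem' _; rewrite exprS -mulrA ler_wpM2l.
Qed.

End FiniteQuasitiling.

(** * Finiteness of fibers *)

(** If A `&` B were infinite, the sets containing all but finitely many of its
points would form a proper filter containing A; a cluster point of this filter in A
would have no neighborhood meeting B in a finite set. *)
Lemma compact_locally_finite (T : topologicalType) (A B : set T) : compact A ->
  (forall x, A x -> exists2 V, nbhs x V & finite_set (V `&` B)) ->
  finite_set (A `&` B).
Proof.
move=> cA locfin; apply: contrapT => infAB.
pose F : set_system T := [set S | finite_set ((A `&` B) `\` S)].
have FF : ProperFilter F.
  split; first by rewrite /F /= setD0.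
  split; rewrite /F /=; first by rewrite setDT.
  - by move=> S1 S2 f1 f2; rewrite /= setDIr finite_setU.
  - by move=> S1 S2 S12; apply: sub_finite_set => x [? nS]; split => // /S12.
have FA : F A.
  by apply: (@sub_finite_set _ _ set0) => // x [[]].
have [x [Ax clx]] := cA F FF FA.
have [V Vx finV] := locfin x Ax.
have FV : F (~` V).
  by apply: (@sub_finite_set _ _ (V `&` B)) => // y [[_ By] /contrapT].
by have [y []] := clx _ _ FV Vx.
Qed.

(** A local homeomorphism is injective on a neighborhood of each point, so such a
neighborhood meets each fiber in at most one point. *)
Lemma finite_fiber (G : topGroupoidType) (f : G -> G) (B A : set G) u :
  local_homeomorphism B f -> compact A -> finite_set [set a | A a /\ f a = u].
Proof.
move=> [_ lf] cA; apply: (@compact_locally_finite _ A [set a | f a = u]) => // x _.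
have [U [oU Ux _ _ [g gK _]]] := lf x.
exists U; first exact: open_nbhs_nbhs.
apply: (@sub_finite_set _ _ [set g u]) => // y [Uy /= <-].
by rewrite gK // inE.
Qed.

(** * Right translation in a groupoid *)

Section GroupoidLemmas.
Variable G : topGroupoidType.
Implicit Types (A C : set G) (g h c u x y : G).

Lemma gmulK x y : src x = rng y -> gmul (gmul x y) (ginv y) = x.
Proof. by move=> xy; rewrite -gmulA ?rng_inv // gmulV -xy gmul_src. Qed.

Lemma gmulVK x y : src x = src y -> gmul (gmul x (ginv y)) y = x.
Proof.
by move=> xy; rewrite -gmulA ?rng_inv ?src_inv // gmulVl -xy gmul_src.
Qed.

Lemma gmulKV x y : src x = rng y -> gmul (ginv x) (gmul x y) = y.
Proof. by move=> xy; rewrite gmulA ?src_inv // gmulVl xy gmul_rng. Qed.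

Lemma src_mulV x y : src x = src y -> src (gmul x (ginv y)) = rng y.
Proof. by move=> xy; rewrite src_mul ?rng_inv // src_inv. Qed.

Lemma rng_mulV x y : src x = src y -> rng (gmul x (ginv y)) = rng x.
Proof. by move=> xy; rewrite rng_mul ?rng_inv. Qed.

Lemma unit_rng x : unit_space G (rng x). Proof. by exists x. Qed.

Lemma translateP A c g :
  translate A c g <-> exists t, [/\ A t, src t = rng c & g = gmul t c].
Proof.
split=> [[[t c'] /= [[At ->] tc] <-]|[t [At tc ->]]]; first by exists t.
by exists (t, c).
Qed.

(** Right division by c identifies the fiber over s(c) with the fiber over r(c); this
form turns membership in a translate into membership in the untranslated set. *)
Lemma translate_divr A c g :
  translate A c g <-> src g = src c /\ A (gmul g (ginv c)).
Proof.
split=> [/translateP[t [At tc ->]]|[gc Agc]]; first by rewrite gmulK // src_mul.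
by apply/translateP; exists (gmul g (ginv c)); rewrite src_mulV // gmulVK.
Qed.

Lemma translate_image A c :
  translate A c = (fun t => gmul t c) @` src_fiber A (rng c).
Proof.
apply/seteqP; split=> g.
  by move=> /translateP[t [At tc ->]]; exists t.
by move=> [t [At tc] <-]; apply/translateP; exists t.
Qed.

Lemma divr_inj c x y : src x = src c -> src y = src c ->
  gmul x (ginv c) = gmul y (ginv c) -> x = y.
Proof. by move=> xc yc e; rewrite -(gmulVK xc) e gmulVK. Qed.

Lemma divl_inj g x y : src x = src g -> src y = src g ->
  gmul g (ginv x) = gmul g (ginv y) -> x = y.
Proof.
move=> xg yg e; have e' : ginv x = ginv y.
  by rewrite -(@gmulKV g (ginv x)) ?e ?gmulKV // rng_inv.
have rxy : rng x = rng y by rewrite -src_inv e' src_inv.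
by rewrite -[LHS]gmul_src xg -yg -gmulVl -e' gmulA ?src_inv ?rng_inv //
  gmulV rxy gmul_rng.
Qed.

Lemma setcard_translate A c : finite_set (src_fiber A (rng c)) ->
  setcard (translate A c) = setcard (src_fiber A (rng c)).
Proof.
move=> fin; rewrite /setcard translate_image fset_set_image //.
apply: card_in_imfset => x y /=; rewrite !in_fset_set // !inE.
move=> [_ xc] [_ yc] e; rewrite -(gmulK xc) e gmulK //.
Qed.

(** If tg = h with t in C and h in A, then r(t) = r(h) and g is determined by t
and h. *)
Lemma finite_boundary C A : (forall u, finite_set (rng_fiber u C)) ->
  finite_set A -> finite_set (boundary C A).
Proof.
move=> finC finA.
apply: (@sub_finite_set _ _
  (\bigcup_(h in A) ((fun t => gmul (ginv t) h) @` rng_fiber (rng h) C))).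
  move=> g [[h [/translateP[t [Ct tg hE]] Ah]] _]; exists h => //.
  by exists t; rewrite hE ?gmulKV //; split => //; rewrite rng_mul.
by apply: bigcup_finite => // h _; apply: finite_image.
Qed.

(** Right translation carries boundaries to boundaries. This transfers a bound on
the boundary of the fibers of A to all translates of A. *)
Lemma boundary_divr C A g c : src g = src c ->
  translate C g `&` translate A c !=set0 ->
  ~ (translate C g `<=` translate A c) ->
  boundary C (src_fiber A (rng c)) (gmul g (ginv c)).
Proof.
move=> gc [h [hC hA]] nsub.
have shift x : translate C g x -> translate C (gmul g (ginv c)) (gmul x (ginv c)).
  move=> /translateP[t [Ct tg ->]]; apply/translateP; exists t; split => //.
    by rewrite rng_mulV.
  by rewrite gmulA // rng_inv.
split.
  exists (gmul h (ginv c)); split; first exact: shift.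
  by move: hA => /translate_divr[hc Ah]; split; rewrite ?src_mulV.
have /existsNP[x /not_implyP[xC xA]] := nsub.
exists (gmul x (ginv c)); split; first exact: shift.
move=> -[Ax _]; apply: xA; apply/translate_divr; split => //.
by move: xC => /translateP[t [_ tg ->]]; rewrite src_mul.
Qed.

End GroupoidLemmas.

(** * Extremal fiber cardinalities *)

Section InfSup.
Variables (R : realType) (G : topGroupoidType) (A : set G).

Lemma inf_src_card_le w : unit_space G w ->
  inf_src_card R A <= (setcard (src_fiber A w))%:R.
Proof.
by move=> Gw; apply: ge_inf; [exists 0 => _ [v _ <-]|exists w].
Qed.

(** A positive ratio forces the supremum to be that of a bounded set: the supremum
of an unbounded set is 0 by convention, and so is the quotient by 0. *)
Lemma sup_rng_card_gt0 : 0 < inf_src_card R A / sup_rng_card R A ->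
  0 < sup_rng_card R A.
Proof.
move=> ratio0; rewrite lt_neqAle eq_sym; apply/andP; split.
  by apply: contraTneq ratio0 => ->; rewrite invr0 mulr0 ltxx.
have [hs|/sup_out] := pselect (has_sup
    [set ((setcard (rng_fiber w A))%:R : R) | w in unit_space G]); last first.
  by rewrite /sup_rng_card => ->.
have [[_ [w Gw _]] _] := hs.
by apply: le_trans (sup_upper_bound hs _); last by exists w.
Qed.

Lemma sup_rng_card_ge w : 0 < sup_rng_card R A -> unit_space G w ->
  (setcard (rng_fiber w A))%:R <= sup_rng_card R A.
Proof.
move=> sup0 Gw; apply: sup_upper_bound; last by exists w.
by apply: contrapT => nsup; move: sup0; rewrite /sup_rng_card sup_out ?ltxx.
Qed.

End InfSup.

(** * The quasitiling theorem *)

Theorem theorem3p8 (R : realType) (G : topGroupoidType)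
  (hlc : locally_compact [set: G]) (hT2 : hausdorff_space G)
  (het : etale G) (hunits : compact (unit_space G))
  (eps : R) (heps0 : 0 < eps) (heps1 : eps < 1 / 2)
  (m : nat) (hm : (2 <= m)%N)
  (n : nat) (hn : (0 < n)%N) (hmn : (1 - eps / m%:R) ^+ n < eps)
  (T : nat -> set G)
  (hTchain : forall i, (1 <= i < n)%N -> T i `<=` T i.+1)
  (hTcompact : forall i, (1 <= i <= n)%N -> compact (T i))
  (hTunits : forall i, (1 <= i <= n)%N -> unit_space G `<=` T i)
  (hi : forall i, (1 <= i <= n)%N ->
     1 / m%:R < inf_src_card R (T i) / sup_rng_card R (T i) <= 1)
  (hii : forall i, (1 <= i <= n)%N ->
     inf_src_card R (T i) / sup_rng_card R (T i) * (1 - eps) >= 1 / m%:R)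
  (hiii : forall i, (2 <= i <= n)%N -> forall w, unit_space G w ->
     (setcard (boundary (T i.-1) (src_fiber (T i) w)))%:R
       <= eps ^+ 2 / 8 * (setcard (src_fiber (T i) w))%:R) :
  forall A : set G,
    approx_invariant (T n) (eps ^+ 2 / 4) A -> quasitiles n T eps A.
Proof.
move=> A [_ _ cA _ invA].
have [het_rng het_src] := het.
have fin_src (B : set G) u : compact B -> finite_set (src_fiber B u).
  exact: finite_fiber het_src.
have fin_rng (B : set G) u : compact B -> finite_set (rng_fiber u B).
  exact: finite_fiber het_rng.
have T_mono i j : (1 <= i <= j)%N -> (j <= n)%N -> T i `<=` T j.
  move=> /andP[i1]; elim: j => [|j IH]; first by case: i i1.
  rewrite leq_eqVlt => /orP[/eqP<- _ g|ij jn] //.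
  apply: subset_trans (IH ij (ltnW jn)) _; apply: hTchain.
  by rewrite jn (leq_trans i1).
have fin_tile i c : (1 <= i <= n)%N -> finite_set (translate (T i) c).
  by move=> hi'; rewrite translate_image; apply/finite_image/fin_src/hTcompact.
pose tile i c : {fset G} := fset_set (translate (T i) c).
have tileE i c g : (1 <= i <= n)%N -> (g \in tile i c) = (g \in translate (T i) c).
  by move=> hi'; rewrite in_fset_set //; apply: fin_tile.
have card_tile i c : (1 <= i <= n)%N ->
    #|` tile i c| = setcard (src_fiber (T i) (rng c)).
  by move=> hi'; apply: setcard_translate; apply/fin_src/hTcompact.
have S_gt0 i : (1 <= i <= n)%N -> 0 < sup_rng_card R (T i).
  move=> /hi/andP[lt _]; apply: sup_rng_card_gt0; apply: le_lt_trans lt.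
  by rewrite divr_ge0.
pose tiles_fiber u (D : {fset nat * G}) := [/\
    forall p, p \in D -> [/\ (1 <= p.1 <= n)%N, src p.2 = u &
                             translate (T p.1) p.2 `<=` A],
    packing (fun p => tile p.1 p.2) eps D &
    (1 - eps) * (setcard (src_fiber A u))%:R <=
      (#|` (\bigcup_(p <- D) tile p.1 p.2)%fset|)%:R].
(* Centers are taken inside Au: this is no restriction, since c lies in T_i c. *)
have fiberwise u : (src @` A) u -> exists D, tiles_fiber u D.
  move=> Au.
  pose X := fset_set (src_fiber A u).
  have XE g : g \in X -> A g /\ src g = u.
    by rewrite in_fset_set; [rewrite inE|exact: fin_src].
  have XI g : A g -> src g = u -> g \in X.
    by move=> Ag gu; rewrite in_fset_set ?inE //; exact: fin_src.
  have [||||||||||D [hD pD cD]] := @finite_quasitiling R G X n m eps tile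
    (fun i => inf_src_card R (T i)) (fun i => sup_rng_card R (T i)) heps0 heps1.
  - by apply: leq_trans hm.
  - move=> i c hi' _; rewrite tileE // inE; apply/translateP.
    by exists (rng c); rewrite src_rng gmul_rng; split => //; apply/hTunits/unit_rng.
  - move=> i j c hij jn; apply/fsubsetP => g.
    have [i1 ij] := andP hij.
    rewrite !tileE ?jn ?i1 ?(leq_trans ij) ?(leq_trans i1) // !inE.
    by move=> /translate_divr[gc Tg]; apply/translate_divr; split=> //; apply: T_mono Tg.
  - by move=> i c hi' _; rewrite card_tile //; apply/inf_src_card_le/unit_rng.
  - move=> i g hi' /XE[_ gu].
    apply: le_trans (sup_rng_card_ge (S_gt0 i hi') (unit_rng g)).
    rewrite ler_nat; apply: (@card_le_inj _ _ (fun c => gmul g (ginv c))).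
    + exact/fin_rng/hTcompact.
    + move=> x y; rewrite !inE => /andP[/XE[_ xu] _] /andP[/XE[_ yu] _].
      by apply: divl_inj; rewrite gu.
    + move=> c; rewrite !inE => /andP[_]; rewrite tileE // inE.
      by move=> /translate_divr[gc Tg]; split => //; rewrite rng_mulV.
  - by move=> i /S_gt0.
  - move=> i hi'; have := hii i hi'; have S0 := S_gt0 i hi'.
    by rewrite -(ler_pM2r S0) [leRHS]mulrAC divfK ?gt_eqF // mulrAC mul1r.
  - move=> j c hj /XE[_ cu]; have [j2 jn] := andP hj.
    have hj' : (1 <= j <= n)%N by rewrite jn (leq_trans _ j2).
    have hj1 : (1 <= j.-1 <= n)%N by lia.
    rewrite card_tile //; apply: le_trans (hiii j hj _ (unit_rng c)).
    rewrite ler_nat; apply: (@card_le_inj _ _ (fun g => gmul g (ginv c))).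
    + apply: finite_boundary; last exact/fin_src/hTcompact.
      by move=> w; apply/fin_rng/hTcompact.
    + move=> x y; rewrite !inE => /andP[/XE[_ xu] _] /andP[/XE[_ yu] _].
      by apply: divr_inj; rewrite cu.
    + move=> g; rewrite !inE => /andP[/XE[_ gu] /andP[dis sub]].
      apply: boundary_divr; first by rewrite gu.
        apply/set0P; apply: contra dis => /eqP I0; apply/fdisjointP => h.
        rewrite !tileE // inE => h1; apply/negP; rewrite inE => h2.
        by have : (translate (T j.-1) g `&` translate (T j) c) h by []; rewrite I0.
      move=> sub'; apply: (negP sub); apply/fsubsetP => h.
      by rewrite !tileE // !inE; apply: sub'.
  - apply: le_trans (invA u Au) _; rewrite ler_nat.
    apply: fsubset_leq_card; apply/fsubsetP => c.
    rewrite in_fset_set ?inE; last first.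
      by apply: sub_finite_set (fin_src A u cA) => x [].
    move=> [[Ac cu] sub]; rewrite XI //=; apply/fsubsetP => g.
    by rewrite tileE ?hn ?leqnn // inE => /sub[Ag gu]; apply: XI.
  - exact: hmn.
  exists D; split => // p pD1; have [hp /XE[_ pu] sub] := hD p pD1.
  split => // g Tg.
  by have /XE[] : g \in X by apply: (fsubsetP sub); rewrite tileE // inE.
(* Glue the fibers: c is a center of shape i when it is one in the tiling of
   its own source fiber. *)
have /choice[D hD] : forall u, exists D, (src @` A) u -> tiles_fiber u D.
  move=> u; have [/fiberwise[D hD]|nAu] := pselect ((src @` A) u); first by exists D.
  by exists fset0.
exists (fun i => [set c | (src @` A) (src c) /\ (i, c) \in D (src c)]).
have inD u p : (src @` A) u -> p \in D u ->
    [/\ (1 <= p.1 <= n)%N, (src @` A) (src p.2) & p \in D (src p.2)].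
  by move=> Au pD; have [hD1 _ _] := hD u Au; have [? -> _] := hD1 p pD.
have fiberE u p : src p.2 = u ->
    src_fiber (translate (T p.1) p.2) u = translate (T p.1) p.2.
  move=> pu; apply/seteqP; split => [g []//|g Tg]; split => //.
  by move: Tg => /translate_divr[->].
have fiber0 u p : src p.2 <> u -> src_fiber (translate (T p.1) p.2) u = set0.
  move=> pu; apply/seteqP; split => // g [/translate_divr[gp _] gu].
  by apply: pu; rewrite -gp.
split.
- move=> g [i /= hi' [[t c] /= [[Tt [Ac cD]] tc] <-]].
  have [hD1 _ _] := hD _ Ac; have [_ _ sub] := hD1 _ cD; apply: sub.
  by apply/translateP; exists t.
- move=> u Au; have [hD1 [H [HF disH cH]] _] := hD u Au.
  exists (fun p => if p \in D u then [set` H p] else set0); split.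
  + move=> p [hp _]; case: ifP => // pD.
    have [_ pu _] := hD1 p pD; rewrite fiberE // => g /= /(fsubsetP (HF p pD)).
    by rewrite tileE // inE.
  + apply/trivIsetP => p q _ _ pq.
    case: ifP => pD; last by rewrite set0I.
    case: ifP => qD; last by rewrite setI0.
    apply/seteqP; split => // g [/= gp gq].
    by have /fdisjointP/(_ g gp) := disH p q pD qD pq; rewrite gq.
  (* A translate whose center lies over another unit misses the fiber over u. *)
  + move=> [i c] /= [hp [Ac cD]].
    have [cu|cu] := pselect (src c = u); last first.
      by rewrite (fiber0 u (i, c)) // /setcard fset_set0 cardfs0 mulr0.
    rewrite -[X in D X]cu cD (fiberE u (i, c)) // /setcard set_fsetK.
    by apply: (cH (i, c)); rewrite -cu.
- move=> u Au; have [hD1 _ cD] := hD u Au; apply: le_trans cD _; rewrite ler_nat.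
  apply: fsubset_leq_card; apply/fsubsetP => g /bigfcupP[p /andP[pD _]].
  have [hp pu sub] := hD1 p pD; rewrite tileE // inE => gp.
  rewrite in_fset_set ?inE.
    exists p; last by rewrite /= fiberE.
    by have [_ Ap pDp] := inD u p Au pD; rewrite /= -surjective_pairing.
  apply: sub_finite_set (fin_src A u cA) => h [q [hq [Aq qD]] [hT hu]].
  have [hD2 _ _] := hD _ Aq; have [_ _ sub2] := hD2 _ qD.
  by split => //; apply: sub2.
Qed.
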